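(* The category $\mathbf{S4DM}$ of S4 De Morgan algebras and their homomorphisms is dually equivalent to the category $\mathbf{S4DMSpec}$ of S4 De Morgan spectral spaces and spectral frame morphisms.
   Context: A De Morgan algebra is a bounded distributive lattice $\langle A;\wedge,\vee,0,1\rangle$ with a unary operation $-$ such that $a\leq b$ implies $-b\leq -a$, and $--a=a$. An S4 De Morgan algebra is a De Morgan algebra with an additional unary operation $\nabla\colon A\to A$ such that $\nabla(a\vee b)=\nabla a\vee\nabla b$, $\nabla 0=0$, $a\leq\nabla a$, and $\nabla\nabla a\leq\nabla a$. Homomorphisms preserve $\wedge,\vee,-,0,1,\nabla$. For a topological space $X$, $\Omega(X)$ is the set of compact open subsets of $X$, and the specialization order is: $x\leqslant y$ iff every open set containing $x$ contains $y$. A spectral space is a compact, $T_0$, sober space $X$ such that $\Omega(X)$ is closed under finite intersections and is a basis for $X$ (sober: every completely prime filter of the lattice of open sets is the set of open neighbourhoods of some point). A map $f\colon X\to Y$ of spectral spaces is a spectral map if $f^{-1}[U]\in\Omega(X)$ for each $U\in\Omega(Y)$. Given a set $X$, a function $g\colon X\to X$ and $R\subseteq X\times X$, for $U\subseteq X$ put $U^*=\{x\in X: g(x)\notin U\}$ and $\nabla_R U=R[U]=\{y\in X:\exists x\in U,\ xRy\}$. An S4 De Morgan spectral space is a structure $\langle X;g,R,\tau\rangle$ such that: (1) $\langle X;\tau\rangle$ is a spectral space, with specialization order $\leqslant$; (2) $g\colon X\to X$ is an order-inverting involution with respect to $\leqslant$, and $R\subseteq X\times X$ is reflexive and transitive;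 (3) if $U\in\Omega(X)$ then $U^*\in\Omega(X)$ and $\nabla_RU\in\Omega(X)$; (4) if not $xRy$, then there is $U\in\Omega(X)$ with $x\in U$ and $y\notin\nabla_RU$. A spectral frame morphism between S4 De Morgan spectral spaces $X$ and $X'$ is a function $f\colon X\to X'$ such that $f$ is a spectral map, $f(g(x))=g(f(x))$ for all $x\in X$, and $f^{-1}[\nabla_RU]=\nabla_Rf^{-1}[U]$ for all $U\in\Omega(X')$ (with $g$, $R$ those of the relevant space). *)

(* Defs.v *)
From mathcomp Require Import all_boot all_order.
From mathcomp Require Import all_classical.
From mathcomp Require Import topology.

Set Implicit Arguments.
Unset Strict Implicit.
Unset Printing Implicit Defensive.

Import Order.TTheory.

Local Open Scope classical_set_scope.

(* Categories, with Leibniz equality of morphisms; [comp g f] is g after f. *)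

Record category := Category {
  obj :> Type;
  hom : obj -> obj -> Type;
  idm : forall A, hom A A;
  comp : forall A B C, hom B C -> hom A B -> hom A C;
  comp1m : forall A B (f : hom A B), comp (idm B) f = f;
  compm1 : forall A B (f : hom A B), comp f (idm A) = f;
  compA : forall A B C D (h : hom C D) (g : hom B C) (f : hom A B),
    comp h (comp g f) = comp (comp h g) f }.

Arguments hom {c} A B.
Arguments idm {c} A.
Arguments comp {c A B C} g f.

Definition op_category (C : category) : category :=
  @Category (obj C) (fun A B => hom B A) (fun A => idm A)
    (fun _ _ _ g f => comp f g)
    (fun _ _ f => compm1 f) (fun _ _ f => comp1m f)
    (fun _ _ _ _ h g f => esym (compA f g h)).

Record functor (C D : category) := Functor {
  fobj :> C -> D;
  fmap : forall A B : C, hom A B -> hom (fobj A) (fobj B);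
  fmap1 : forall A : C, fmap (idm A) = idm (fobj A);
  fmap_comp : forall (A B E : C) (g : hom B E) (f : hom A B),
    fmap (comp g f) = comp (fmap g) (fmap f) }.

Arguments fmap {C D} F {A B} f : rename.

Definition id_functor (C : category) : functor C C :=
  @Functor C C id (fun _ _ f => f) (fun _ => erefl) (fun _ _ _ _ _ => erefl).

Section comp_functor.
Variables (C D E : category) (G : functor D E) (F : functor C D).

Definition comp_fmap A B (f : hom A B) : hom (G (F A)) (G (F B)) := fmap G (fmap F f).

Lemma comp_fmap1 A : comp_fmap (idm A) = idm (G (F A)).
Proof. by rewrite /comp_fmap !fmap1. Qed.

Lemma comp_fmap_comp A B B' (g : hom B B') (f : hom A B) :
  comp_fmap (comp g f) = comp (comp_fmap g) (comp_fmap f).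
Proof. by rewrite /comp_fmap !fmap_comp. Qed.

Definition comp_functor : functor C E :=
  @Functor C E (fun A => G (F A)) comp_fmap comp_fmap1 comp_fmap_comp.

End comp_functor.

Definition naturally_isomorphic (C D : category) (F G : functor C D) : Prop :=
  exists (eta : forall A : C, hom (F A) (G A))
         (eps : forall A : C, hom (G A) (F A)),
    [/\ forall (A B : C) (f : hom A B),
          comp (eta B) (fmap F f) = comp (fmap G f) (eta A),
        forall A : C, comp (eps A) (eta A) = idm (F A) &
        forall A : C, comp (eta A) (eps A) = idm (G A)].

Definition equivalent_categories (C D : category) : Prop :=
  exists (F : functor C D) (G : functor D C),
    naturally_isomorphic (id_functor C) (comp_functor G F) /\
    naturally_isomorphic (comp_functor F G) (id_functor D).

Definition dually_equivalent (C D : category) : Prop :=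
  equivalent_categories (op_category C) D.

(* Concrete categories: morphisms are functions satisfying a predicate. *)

Section concrete_category.
Variables (O : Type) (carrier : O -> Type).
Variable is_mor : forall A B : O, (carrier A -> carrier B) -> Prop.
Hypothesis is_mor_id : forall A : O, is_mor (@id (carrier A)).
Hypothesis is_mor_comp :
  forall (A B C : O) (g : carrier B -> carrier C) (f : carrier A -> carrier B),
  is_mor g -> is_mor f -> is_mor (g \o f).

Definition mor (A B : O) : Type := {f : carrier A -> carrier B | is_mor f}.

Definition id_mor (A : O) : mor A A := exist _ _ (is_mor_id A).

Definition comp_mor (A B C : O) (g : mor B C) (f : mor A B) : mor A C :=
  exist _ _ (is_mor_comp (proj2_sig g) (proj2_sig f)).

Lemma mor_eq (A B : O) (f g : mor A B) : proj1_sig f = proj1_sig g -> f = g.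
Proof.
case: f g => [f fP] [g gP] /= fg; case: _ / fg gP => gP.
by rewrite (Prop_irrelevance fP gP).
Qed.

Lemma comp_mor1m A B (f : mor A B) : comp_mor (id_mor B) f = f.
Proof. exact: mor_eq. Qed.

Lemma comp_morm1 A B (f : mor A B) : comp_mor f (id_mor A) = f.
Proof. exact: mor_eq. Qed.

Lemma comp_morA A B C D (h : mor C D) (g : mor B C) (f : mor A B) :
  comp_mor h (comp_mor g f) = comp_mor (comp_mor h g) f.
Proof. exact: mor_eq. Qed.

Definition concrete_category : category :=
  @Category O mor id_mor comp_mor comp_mor1m comp_morm1 comp_morA.

End concrete_category.

(* The display [dm_disp] only affects notations; 0 = 1 is allowed. *)
Record deMorganAlgebra := DeMorganAlgebra {
  dm_disp : Order.disp_t;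
  dm_lattice :> tbDistrLatticeType dm_disp;
  dm_neg : dm_lattice -> dm_lattice;
  dm_neg_anti : forall a b : dm_lattice, (a <= b)%O -> (dm_neg b <= dm_neg a)%O;
  dm_negK : involutive dm_neg }.

Arguments dm_neg {d} a : rename.

Record s4DeMorganAlgebra := S4DeMorganAlgebra {
  s4_dm :> deMorganAlgebra;
  nabla : s4_dm -> s4_dm;
  nablaU : forall a b : s4_dm, nabla (a `|` b)%O = (nabla a `|` nabla b)%O;
  nabla0 : nabla \bot%O = \bot%O;
  nabla_ge : forall a : s4_dm, (a <= nabla a)%O;
  nabla_nabla : forall a : s4_dm, (nabla (nabla a) <= nabla a)%O }.

Arguments nabla {s} a : rename.

Record s4dm_hom (A B : s4DeMorganAlgebra) (h : A -> B) : Prop := S4DMHom {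
  s4dm_homI : forall a b : A, h (a `&` b)%O = (h a `&` h b)%O;
  s4dm_homU : forall a b : A, h (a `|` b)%O = (h a `|` h b)%O;
  s4dm_homN : forall a : A, h (dm_neg a) = dm_neg (h a);
  s4dm_hom0 : h \bot%O = \bot%O;
  s4dm_hom1 : h \top%O = \top%O;
  s4dm_hom_nabla : forall a : A, h (nabla a) = nabla (h a) }.

Lemma s4dm_hom_id (A : s4DeMorganAlgebra) : s4dm_hom (@id A).
Proof. by split. Qed.

Lemma s4dm_hom_comp (A B C : s4DeMorganAlgebra) (g : B -> C) (f : A -> B) :
  s4dm_hom g -> s4dm_hom f -> s4dm_hom (g \o f).
Proof.
move=> [gI gU gN g0 g1 gn] [fI fU fN f0 f1 fn].
split=> [a b|a b|a|||a] /=; first by rewrite fI gI.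
- by rewrite fU gU.
- by rewrite fN gN.
- by rewrite f0 g0.
- by rewrite f1 g1.
- by rewrite fn gn.
Qed.

Definition S4DM : category := concrete_category s4dm_hom_id s4dm_hom_comp.

Definition compact_opens (X : topologicalType) : set (set X) :=
  [set U | compact U /\ open U].

Arguments compact_opens : clear implicits.

(* Equivalently, x lies in the closure of {y}; beware that the converse order is
   also in use. *)
Definition specialization (X : topologicalType) (x y : X) : Prop :=
  forall U : set X, open U -> U x -> U y.

Record completely_prime_filter (X : topologicalType) (P : set (set X)) : Prop :=
  CompletelyPrimeFilter {
  cpf_open : P `<=` open;
  cpfT : P setT;
  cpfI : forall U V : set X, P U -> P V -> P (U `&` V);
  cpfS : forall U V : set X, open V -> U `<=` V -> P U -> P V;
  cpf_prime : forall D : set (set X), D `<=` open ->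
    P (\bigcup_(U in D) U) -> exists2 U, D U & P U }.

(* [cpf_prime] with D empty makes such filters proper. *)
Definition sober (X : topologicalType) : Prop :=
  forall P : set (set X), completely_prime_filter P ->
  exists x : X, P = [set U | open U /\ U x].

Record spectral_space (X : topologicalType) : Prop := SpectralSpace {
  spectral_compact : compact [set: X];
  spectral_T0 : kolmogorov_space X;
  spectral_sober : sober X;
  spectral_compact_opensI : forall U V : set X,
    compact_opens X U -> compact_opens X V -> compact_opens X (U `&` V);
  spectral_basis : basis (compact_opens X) }.

Definition spectral_map (X Y : topologicalType) (f : X -> Y) : Prop :=
  forall U : set Y, compact_opens Y U -> compact_opens X (f @^-1` U).

Definition set_star (X : Type) (g : X -> X) (U : set X) : set X :=
  [set x | ~ U (g x)].

Definition set_nabla (X : Type) (R : X -> X -> Prop) (U : set X) : set X :=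
  [set y | exists2 x, U x & R x y].

Record s4dmSpectralSpace := S4DMSpectralSpace {
  sp_space :> topologicalType;
  sp_g : sp_space -> sp_space;
  sp_R : sp_space -> sp_space -> Prop;
  sp_spectral : spectral_space sp_space;
  sp_g_anti : forall x y : sp_space,
    specialization x y -> specialization (sp_g y) (sp_g x);
  sp_gK : involutive sp_g;
  sp_R_refl : forall x : sp_space, sp_R x x;
  sp_R_trans : forall x y z : sp_space, sp_R x y -> sp_R y z -> sp_R x z;
  sp_star : forall U : set sp_space,
    compact_opens sp_space U -> compact_opens sp_space (set_star sp_g U);
  sp_nabla : forall U : set sp_space,
    compact_opens sp_space U -> compact_opens sp_space (set_nabla sp_R U);
  sp_sep : forall x y : sp_space, ~ sp_R x y ->
    exists U : set sp_space,
      [/\ compact_opens sp_space U, U x & ~ set_nabla sp_R U y] }.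

Arguments sp_g {s} x : rename.
Arguments sp_R {s} x y : rename.

Record spectral_frame_morphism (X Y : s4dmSpectralSpace) (f : X -> Y) : Prop :=
  SpectralFrameMorphism {
  sfm_spectral : spectral_map f;
  sfm_g : forall x : X, f (sp_g x) = sp_g (f x);
  sfm_nabla : forall U : set Y, compact_opens Y U ->
    f @^-1` set_nabla sp_R U = set_nabla sp_R (f @^-1` U) }.

Lemma spectral_frame_morphism_id (X : s4dmSpectralSpace) :
  spectral_frame_morphism (@id X).
Proof. by split. Qed.

Lemma spectral_frame_morphism_comp (X Y Z : s4dmSpectralSpace)
    (g : Y -> Z) (f : X -> Y) :
  spectral_frame_morphism g -> spectral_frame_morphism f ->
  spectral_frame_morphism (g \o f).
Proof.
move=> [gs gg gn] [fs fg fn]; split=> [U cU|x|U cU].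
- exact: (fs _ (gs _ cU)).
- by rewrite /= fg gg.
- by rewrite comp_preimage (gn U cU) (fn _ (gs _ cU)).
Qed.

Definition S4DMSpec : category :=
  concrete_category spectral_frame_morphism_id spectral_frame_morphism_comp.

(* Main.v *)
From HB Require Import structures.
From mathcomp Require Import all_boot all_order.
From mathcomp Require Import all_classical.
From mathcomp Require Import topology.
Require Import Defs.

Set Implicit Arguments.
Unset Strict Implicit.
Unset Printing Implicit Defensive.

Import Order.TTheory.

Local Open Scope classical_set_scope.

(* Stone duality for bounded distributive lattices, carried along with the
   extra operations.  An algebra A goes to the space of its prime filters, with
   basic opens [stone a] = {P | a \in P}, g P = {a | - a \notin P} and P R Q iff
   nabla maps P into Q; a space X goes to its lattice of compact opens.  The
   units a |-> stone a and x |-> {U | x \in U} are bijective by the prime filter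
   theorem, resp. by sobriety, and turn the operations of one side into those of
   the other.  The identity R[stone a] = stone (nabla a) is again an instance of
   the prime filter theorem, as {b | nabla b \notin Q} is an ideal. *)

(** * Natural isomorphisms and bijections *)

Lemma natural_isomorphism (C D : category) (F G : functor C D)
    (eta : forall A : C, hom (F A) (G A)) :
  (forall (A B : C) (f : hom A B),
     comp (eta B) (fmap F f) = comp (fmap G f) (eta A)) ->
  (forall A : C, exists e : hom (G A) (F A),
     comp e (eta A) = idm (F A) /\ comp (eta A) e = idm (G A)) ->
  naturally_isomorphic F G.
Proof.
(* Componentwise inverses are only known to exist; choice assembles them into a family. *)
move=> nat iso; exists eta, (fun A => proj1_sig (cid (iso A))).
by split=> // A; case: cid => e [].
Qed.

(** The inverse components are natural: insert [eta A] after [eps A] on the right, move [f] across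
    [eta] by naturality, and cancel. *)
Lemma naturally_isomorphic_sym (C D : category) (F G : functor C D) :
  naturally_isomorphic F G -> naturally_isomorphic G F.
Proof.
move=> [eta [eps [nat epsK etaK]]]; exists eps, eta; split=> // A B f.
rewrite -[LHS]compm1 -(etaK A) compA -(compA (eps B)) -nat.
by rewrite compA epsK comp1m.
Qed.

Lemma bijection_inverse (T U : Type) (h : T -> U) :
  injective h -> (forall y, exists x, h x = y) ->
  exists k : U -> T, cancel h k /\ cancel k h.
Proof.
move=> inj /choice[k hk]; exists k; split=> // x.
by apply: inj; rewrite hk.
Qed.

(** * Prime filters *)

Section prime_filters.
Context {d : Order.disp_t} {L : tbDistrLatticeType d}.
Implicit Types (a b c : L).

Record ideal (I : set L) : Prop := Ideal {
  ideal0 : I \bot%O;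
  ideal_le : forall a b, (a <= b)%O -> I b -> I a;
  idealU : forall a b, I a -> I b -> I (a `|` b)%O }.

(** A type rather than a predicate on sets, so that it can carry a topology. For the one-element
    lattice it is empty, as [pf1] and [pf0] then conflict. *)
Record prime_filter : Type := PrimeFilter {
  pf_set :> L -> Prop;
  pf1 : pf_set \top%O;
  pf0 : ~ pf_set \bot%O;
  pf_le : forall a b, (a <= b)%O -> pf_set a -> pf_set b;
  pfI : forall a b, pf_set a -> pf_set b -> pf_set (a `&` b)%O;
  pfU : forall a b, pf_set (a `|` b)%O -> pf_set a \/ pf_set b }.

Lemma prime_filter_eq (P Q : prime_filter) :
  (forall a, P a <-> Q a) -> P = Q.
Proof.
case: P Q => [p ? ? ? ? ?] [q q1 q0 qle qI qU] /= pq.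
have {pq} /esym pq : p = q by apply: funext => a; apply: propext.
by subst q; congr PrimeFilter; exact: Prop_irrelevance.
Qed.

Lemma pfIE (P : prime_filter) a b : P (a `&` b)%O <-> P a /\ P b.
Proof.
split=> [ab|[]]; last exact: pfI.
by split; apply: pf_le ab; [exact: leIl|exact: leIr].
Qed.

Lemma pfUE (P : prime_filter) a b : P (a `|` b)%O <-> P a \/ P b.
Proof.
split=> [|[]]; first exact: pfU.
  by apply: pf_le; exact: leUl.
by apply: pf_le; exact: leUr.
Qed.

(* Zorn's lemma is applied to the possibly empty filters whose trace below [a]
   misses [I], so that the empty chain needs no separate treatment. *)
Theorem prime_filter_theorem (I : set L) a : ideal I -> ~ I a ->
  exists P : prime_filter, P a /\ forall b, P b -> ~ I b.
Proof.
move=> [I0 Ile IU] nIa.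
pose ok (S : set L) := [/\ forall b c, (b <= c)%O -> S b -> S c,
  forall b c, S b -> S c -> S (b `&` c)%O & forall s, S s -> ~ I (a `&` s)%O].
have [F Fok Ftot|M [[Mle MI MD] Mmax]] := @Zorn_bigcup L ok.
  split.
  - move=> b c bc [S FS Sb]; exists S => //.
    by have [Sle _ _] := Fok S FS; exact: Sle Sb.
  - move=> b c [S FS Sb] [T FT Tc].
    have [ST|TS] := Ftot _ _ FS FT.
      by exists T => //; have [_ TI _] := Fok T FT; apply: TI => //; exact: ST.
    by exists S => //; have [_ SI _] := Fok S FS; apply: SI => //; exact: TS.
  - by move=> s [S FS Ss]; have [_ _ SD] := Fok S FS; exact: SD.
have Madd b : ~ I (a `&` b)%O ->
    (forall s, M s -> ~ I (a `&` (s `&` b))%O) -> M b.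
  move=> nIb nIMb; apply: contrapT => nMb.
  (* [N] is the filter generated by [M] and [b]. The first disjunct is there because [M] is not yet
     known to be nonempty. *)
  pose N := [set c | (b <= c)%O \/ exists2 s, M s & (s `&` b <= c)%O].
  apply: (Mmax N); first split.
  - by move=> c Mc; right; exists c => //; exact: leIl.
  - by move=> /(_ b) NM; apply/nMb/NM; left.
  split.
  - move=> c e ce [bc|[s Ms sc]]; first by left; exact: le_trans ce.
    by right; exists s => //; exact: le_trans ce.
  - move=> c e [bc|[s Ms sc]] [be|[t Mt te]].
    + by left; rewrite lexI bc.
    + right; exists t => //; rewrite lexI te andbT.
      by apply: le_trans bc; exact: leIr.
    + right; exists s => //; rewrite lexI sc.
      by apply: le_trans be; exact: leIr.
    + right; exists (s `&` t)%O; first exact: MI.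
      rewrite lexI; apply/andP; split.
        by apply: le_trans sc; apply: leI2 => //; exact: leIl.
      by apply: le_trans te; apply: leI2 => //; exact: leIr.
  - move=> c [bc|[s Ms sc]] Ic.
      by apply: nIb; apply: Ile Ic; exact: leI2.
    by apply: (nIMb s Ms); apply: Ile Ic; exact: leI2.
have Ma : M a.
  apply: Madd; first by rewrite meetxx.
  by move=> s Ms; rewrite (meetC s) meetA meetxx; exact: MD.
have M1 : M \top%O by apply: (Mle a) => //; exact: lex1.
have M0 : ~ M \bot%O by move=> /MD; rewrite meetx0.
(* [Madd] in contrapositive form; if [b] already conflicts with [a] alone, the witness is the top
   element. *)
have notM b : ~ M b -> exists2 s, M s & I (a `&` (s `&` b))%O.
  move=> nMb; apply: contrapT => no; apply: nMb; apply: Madd => [Ib|s Ms Is].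
    by apply: no; exists \top%O => //; rewrite meet1x.
  by apply: no; exists s.
(* If [s] excludes [b] and [t] excludes [c], distributivity puts the meet of [a], [s], [t] and the
   join of [b] and [c] into [I], against [MD]. *)
have MU b c : M (b `|` c)%O -> M b \/ M c.
  move=> Mbc; apply: contrapT => /not_orP[/notM[s Ms Is] /notM[t Mt It]].
  apply: (MD ((s `&` t) `&` (b `|` c))%O); first exact: MI (MI _ _ Ms Mt) Mbc.
  rewrite meetUr meetUr; apply: IU.
    by apply: Ile Is; apply: leI2 => //; apply: leI2 => //; exact: leIl.
  by apply: Ile It; apply: leI2 => //; apply: leI2 => //; exact: leIr.
exists (PrimeFilter M1 M0 Mle MI MU); split=> // b Mb Ib.
by apply: (MD b Mb); apply: Ile Ib; exact: leIr.
Qed.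

(** This is the prime filter theorem for the principal ideal of [b]; it makes [stone] injective. *)
Lemma prime_filter_sep a b : ~~ (a <= b)%O ->
  exists P : prime_filter, P a /\ ~ P b.
Proof.
move=> nab; have [||P [Pa Pb]] := @prime_filter_theorem [set c | (c <= b)%O] a.
- split=> [|c e ce /(le_trans ce)//|c e /= cb eb]; first exact: le0x.
  by rewrite /= leUx cb.
- exact/negP.
- by exists P; split=> // /Pb; apply; exact: lexx.
Qed.

Definition stone a : set prime_filter := [set P | P a].

Lemma stone_inj : injective stone.
Proof.
have le a b : stone a `<=` stone b -> (a <= b)%O.
  move=> ab; apply: contrapT => /negP/prime_filter_sep[P [Pa]]; apply.
  exact: (ab P Pa).
by move=> a b ab; apply/eqP; rewrite eq_le !le // ab.
Qed.

Lemma stone0 : stone \bot%O = set0.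
Proof. by rewrite -subset0 => P /pf0. Qed.

Lemma stone1 : stone \top%O = setT.
Proof. by rewrite -subTset => P _; exact: pf1. Qed.

Lemma stoneI a b : stone (a `&` b)%O = stone a `&` stone b.
Proof. by apply/seteqP; split=> P /pfIE. Qed.

Lemma stoneU a b : stone (a `|` b)%O = stone a `|` stone b.
Proof. by apply/seteqP; split=> P /pfUE. Qed.

(** The sets [stone a] are closed under finite intersections, so the unions of such sets already
    form a topology. *)
Definition stone_open (U : set prime_filter) : Prop :=
  forall P, U P -> exists2 a, P a & stone a `<=` U.

Lemma stone_openT : stone_open setT.
Proof. by move=> P _; exists \top%O => //; exact: pf1. Qed.

Lemma stone_openI : setI_closed stone_open.
Proof.
move=> U V oU oV P [/oU[a Pa aU] /oV[b Pb bV]].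
exists (a `&` b)%O; first exact: pfI.
by rewrite stoneI; exact: setISS.
Qed.

Lemma stone_open_bigU (J : Type) (f : J -> set prime_filter) :
  (forall i, stone_open (f i)) -> stone_open (\bigcup_i f i).
Proof.
move=> of_ P [i _ /of_[a Pa af]]; exists a => //.
by apply: subset_trans af _ => Q fQ; exists i.
Qed.

End prime_filters.

Arguments prime_filter {d} L.

HB.instance Definition _ d (L : tbDistrLatticeType d) :=
  gen_eqMixin (prime_filter L).
HB.instance Definition _ d (L : tbDistrLatticeType d) :=
  gen_choiceMixin (prime_filter L).
HB.instance Definition _ d (L : tbDistrLatticeType d) :=
  isOpenTopological.Build (prime_filter L)
    stone_openT stone_openI stone_open_bigU.

(** * The prime filters form a spectral space *)

Section prime_spectrum.
Context {d : Order.disp_t} {L : tbDistrLatticeType d}.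
Implicit Types (a b c : L) (P Q : prime_filter L).

Lemma open_stoneP (U : set (prime_filter L)) : open U <-> stone_open U.
Proof. by []. Qed.

Lemma open_stone a : open (stone a).
Proof. by apply/open_stoneP => P Pa; exists a. Qed.

Lemma nbhs_stone P a : P a -> nbhs P (stone a).
Proof. by move=> Pa; apply: open_nbhs_nbhs; split=> //; exact: open_stone. Qed.

(* The ideal of those [b] with [stone b] negligible for a filter is proper, and a
   prime filter avoiding it is a cluster point. *)
Lemma compact_stone a : compact (stone a).
Proof.
move=> F FF Fa.
have [||P [Pa PF]] := @prime_filter_theorem _ L [set b | F (~` stone b)] a.
- split=> [|b c bc|b c /= Fb Fc].
  + by rewrite /= stone0 setC0; exact: filterT.
  + by apply: filterS; apply: subsetC => P; exact: pf_le.
  + by rewrite stoneU setCU; exact: filterI.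
- move=> /= Fna; apply: (@filter_not_empty _ F).
  by rewrite -(setICr (stone a)); exact: filterI.
exists P; split=> // S V FS; rewrite nbhsE => -[W [/open_stoneP oW WP] WV].
have [b Pb bW] := oW P WP.
apply: contrapT => /set0P/negP/negPn/eqP SV; apply: (PF b Pb).
apply: filterS FS => Q SQ bQ.
suff : set0 Q by [].
by rewrite -SV; split=> //; exact/WV/bW.
Qed.

Lemma compact_opens_stone a : compact_opens (prime_filter L) (stone a).
Proof. by split; [exact: compact_stone|exact: open_stone]. Qed.

(** If [U] is not basic, the sets [U] minus [stone a], for [stone a] inside [U], generate a proper
    filter, as finite unions of basic sets are basic. Compactness gives it a cluster point in [U],
    but a basic neighbourhood of that point inside [U] misses one of these sets. *)
Lemma compact_opens_stoneP (U : set (prime_filter L)) :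
  compact_opens (prime_filter L) U -> exists a, stone a = U.
Proof.
move=> [cU /open_stoneP oU]; apply: contrapT => noU.
pose F := filter_from [set a | stone a `<=` U] (fun a => U `\` stone a).
have FF : ProperFilter F.
  apply: filter_from_proper.
    apply: filter_from_filter; first by exists \bot%O; rewrite /= stone0.
    move=> a b aU bU; exists (a `|` b)%O; first by rewrite /= stoneU subUset.
    by rewrite stoneU setDUr.
  move=> a aU; apply/set0P/eqP => /subsets_disjoint.
  rewrite -?setDE => Ua; apply: noU; exists a; apply/seteqP; split=> //.
have [P [UP clP]] : U `&` cluster F !=set0.
  by apply: cU; exists \bot%O; [rewrite /= stone0|move=> P []].
have [a Pa aU] := oU P UP.
have Fa : F (U `\` stone a) by exists a.
have [Q [[_ naQ] aQ]] := clP _ _ Fa (nbhs_stone Pa).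
exact: naQ.
Qed.

Lemma specialization_prime_filter P Q :
  specialization P Q <-> (forall a, P a -> Q a).
Proof.
split=> [PQ a|PQ U /open_stoneP oU /oU[a /PQ Qa]]; last exact.
by apply: (PQ (stone a)); exact: open_stone.
Qed.

(** The point is the set of all [a] with [stone a] in [T]. Complete primeness makes it proper, by
    the empty cover, and prime, by covers with two members. Applied to the cover of an open set by
    basic ones, it shows that this point induces [T]. *)
Lemma sober_prime_filter : sober (prime_filter L).
Proof.
move=> T [Topen TT TI TS Tprime].
have T0 : ~ T (stone (\bot%O : L)).
  by rewrite stone0 -(bigcup_set0 id) => T0; have [|U []] := Tprime set0 _ T0.
have Tle a b : (a <= b)%O -> T (stone a) -> T (stone b).
  by move=> ab; apply: TS; [exact: open_stone|move=> P; exact: pf_le].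
have T1 : T (stone (\top%O : L)) by rewrite stone1.
have TmI a b : T (stone a) -> T (stone b) -> T (stone (a `&` b)%O).
  by rewrite stoneI; exact: TI.
have TmU a b : T (stone (a `|` b)%O) -> T (stone a) \/ T (stone b).
  rewrite stoneU => Tab.
  have [||U] := Tprime [set stone a; stone b].
  - by move=> _ [->|->]; exact: open_stone.
  - by rewrite bigcup_setU !bigcup_set1.
  - by move=> [->|->]; [left|right].
exists (PrimeFilter T1 T0 Tle TmI TmU); apply/seteqP; split=> U.
  move=> TU; have oU := Topen _ TU; split=> //.
  have [||V [a aU <-] Ta] :=
    Tprime [set stone a | a in [set a | stone a `<=` U]].
  - by move=> _ [a _ <-]; exact: open_stone.
  - apply: TS TU; first by apply: bigcup_open => _ [a _ <-]; exact: open_stone.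
    move=> P /((open_stoneP U).1 oU)[a Pa aU].
    by exists (stone a) => //; exists a.
  - by apply: aU.
move=> [oU /((open_stoneP U).1 oU)[a Ta aU]].
exact: TS Ta.
Qed.

Lemma spectral_prime_filter : spectral_space (prime_filter L).
Proof.
split.
- by rewrite -stone1; exact: compact_stone.
- move=> P Q /eqP PQ.
  have [a] : exists a, ~ (P a <-> Q a).
    apply: contrapT => /forallNP PQ'; apply/PQ/prime_filter_eq => a.
    exact: contrapT.
  case: (pselect (P a)) (pselect (Q a)) => [Pa|nPa] [Qa|nQa] nPQ.
  + by case: nPQ.
  + by exists (stone a); left; rewrite !inE; split=> //; exact: nbhs_stone.
  + by exists (stone a); right; rewrite !inE; split=> //; exact: nbhs_stone.
  + by case: nPQ.
- exact: sober_prime_filter.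
- move=> _ _ /compact_opens_stoneP[a <-] /compact_opens_stoneP[b <-].
  by rewrite -stoneI; exact: compact_opens_stone.
- split=> [U []//|P V]; rewrite nbhsE => -[W [/open_stoneP oW WP] WV].
  have [a Pa aW] := oW P WP; exists (stone a); last exact: subset_trans WV.
  by split=> //; exact: compact_opens_stone.
Qed.

End prime_spectrum.

(** * The lattice of compact open sets *)

(** The proof [spX] is a parameter of the type so that instance inference can supply the meet and
    the top element, which depend on it. *)
Record compact_open (X : topologicalType) (spX : spectral_space X) : Type :=
  CompactOpen {
  co_set :> set X;
  co_compact_open : compact_opens X co_set }.

Section compact_open_lattice.
Context {X : topologicalType} {spX : spectral_space X}.
Local Notation co := (compact_open spX).
Implicit Types U V W : co.

Lemma compact_open_eq U V : co_set U = co_set V -> U = V.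
Proof.
case: U V => [U cU] [V cV] /= UV; subst V.
by congr CompactOpen; exact: Prop_irrelevance.
Qed.

Lemma compact_opens0 : compact_opens X set0.
Proof. by split; [exact: compact0|exact: open0]. Qed.

Lemma compact_opensT : compact_opens X setT.
Proof. by split; [exact: (spectral_compact spX)|exact: openT]. Qed.

Lemma compact_opensU (U V : set X) :
  compact_opens X U -> compact_opens X V -> compact_opens X (U `|` V).
Proof.
by move=> [? ?] [? ?]; split; [exact: compactU|exact: openU].
Qed.

Definition co0 : co := CompactOpen spX compact_opens0.
Definition co1 : co := CompactOpen spX compact_opensT.
Definition coI U V : co := CompactOpen spX
  (spectral_compact_opensI spX (co_compact_open U) (co_compact_open V)).
Definition coU U V : co := CompactOpen spX
  (compact_opensU (co_compact_open U) (co_compact_open V)).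
End compact_open_lattice.

HB.instance Definition _ X (spX : spectral_space X) :=
  gen_eqMixin (compact_open spX).
HB.instance Definition _ X (spX : spectral_space X) :=
  gen_choiceMixin (compact_open spX).

Section compact_open_order.
Context {X : topologicalType} {spX : spectral_space X}.
Local Notation co := (compact_open spX).
Implicit Types U V W : co.

(** The order is given through the meet, as the lattice builder expects; [co_leP] recovers
    inclusion. *)
Definition co_le U V : bool := coI U V == U.
Definition co_lt U V : bool := (V != U) && co_le U V.

Lemma co_le_def U V : co_le U V = (coI U V == U). Proof. by []. Qed.
Lemma co_lt_def U V : co_lt U V = (V != U) && co_le U V. Proof. by []. Qed.
Lemma coIC : commutative (@coI X spX).
Proof. by move=> U V; apply: compact_open_eq; exact: setIC. Qed.
Lemma coUC : commutative (@coU X spX).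
Proof. by move=> U V; apply: compact_open_eq; exact: setUC. Qed.
Lemma coIA : associative (@coI X spX).
Proof. by move=> U V W; apply: compact_open_eq; exact: setIA. Qed.
Lemma coUA : associative (@coU X spX).
Proof. by move=> U V W; apply: compact_open_eq; exact: setUA. Qed.
Lemma coUKI V U : coI U (coU U V) = U.
Proof. by apply: compact_open_eq; rewrite /= setUC; exact: setKU. Qed.
Lemma coIKU V U : coU U (coI U V) = U.
Proof. by apply: compact_open_eq; rewrite /= setIC; exact: setKI. Qed.
Lemma coIUl : left_distributive (@coI X spX) (@coU X spX).
Proof. by move=> U V W; apply: compact_open_eq; exact: setIUl. Qed.
Lemma coII : idempotent_op (@coI X spX).
Proof. by move=> U; apply: compact_open_eq; exact: setIid. Qed.
Lemma co_le0 U : co_le co0 U.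
Proof. by apply/eqP/compact_open_eq; exact: set0I. Qed.
Lemma co_le1 U : co_le U co1.
Proof. by apply/eqP/compact_open_eq; exact: setIT. Qed.
End compact_open_order.

Fact compact_open_display : Order.disp_t. Proof. exact: Order.Disp tt tt. Qed.

HB.instance Definition _ X (spX : spectral_space X) :=
  Order.isMeetJoinDistrLattice.Build compact_open_display (compact_open spX)
    (@co_le_def X spX) (@co_lt_def X spX)
    coIC coUC coIA coUA coUKI coIKU coIUl coII.
HB.instance Definition _ X (spX : spectral_space X) :=
  Order.hasBottom.Build compact_open_display (compact_open spX) (@co_le0 X spX).
HB.instance Definition _ X (spX : spectral_space X) :=
  Order.hasTop.Build compact_open_display (compact_open spX) (@co_le1 X spX).

Section compact_open_points.
Context {X : topologicalType} {spX : spectral_space X}.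
Local Notation co := (compact_open spX).
Implicit Types U V W : co.

Lemma co_leP U V : (U <= V)%O <-> co_set U `<=` V.
Proof.
split=> [/eqP UV x Ux|UV].
  have: co_set (coI U V) x by rewrite UV.
  by case.
by apply/eqP/compact_open_eq; exact/setIidPl.
Qed.

Lemma compact_open_nbhs (x : X) (V : set X) : open V -> V x ->
  exists2 U : co, co_set U x & co_set U `<=` V.
Proof.
move=> oV Vx; have [_ /(_ x V)] := spectral_basis spX.
have Vn : nbhs x V by exact: open_nbhs_nbhs.
by move=> /(_ Vn)[U [cU Ux] UV]; exists (CompactOpen spX cU).
Qed.

Definition point_filter (x : X) : prime_filter co :=
  @PrimeFilter _ co (fun U => co_set U x) I id
    (fun U V UV => (co_leP U V).1 UV x) (fun _ _ => @conj _ _) (fun _ _ => id).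

(** Compact opens form a basis, so points with the same point filter lie in the same open sets, and
    the T0 axiom applies. *)
Lemma point_filter_inj : injective point_filter.
Proof.
have sub (x y : X) A : point_filter x = point_filter y -> nbhs x A -> A y.
  move=> xy; rewrite nbhsE => -[V [oV Vx]]; apply.
  have [U Ux UV] := compact_open_nbhs oV Vx; apply: UV.
  by rewrite -[_ y]/(point_filter y U) -xy.
move=> x y xy; apply: contrapT => /eqP/(spectral_T0 spX)[A].
rewrite !inE => -[[xA]|[yA]]; apply; first exact: sub xA.
exact: sub (esym xy) yA.
Qed.

(* The opens including a member of [Q] form a completely prime filter: a compact
   open [U] in [Q] covered by opens without this property would have a cluster
   point along the sets [U `\` W], for [W] compact open outside [Q]. *)
Lemma point_filter_surj (Q : prime_filter co) : exists x, point_filter x = Q.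
Proof.
pose T := [set V : set X | open V /\ exists2 U : co, Q U & co_set U `<=` V].
have [|x Tx] := spectral_sober spX (P := T).
  split.
  - by move=> V [].
  - by split; [exact: openT|exists \top%O => //; exact: pf1].
  - move=> V W [oV [U QU UV]] [oW [U' QU' UW]]; split; first exact: openI.
    by exists (U `&` U')%O; [exact: pfI|exact: setISS].
  - move=> V W oW VW [_ [U QU UV]]; split=> //.
    by exists U => //; exact: subset_trans VW.
  - move=> D Dopen [_ [U QU UD]]; apply: contrapT => noD.
    pose F := filter_from [set W : co | ~ Q W] (fun W => co_set U `\` co_set W).
    have FF : ProperFilter F.
      apply: filter_from_proper.
        apply: filter_from_filter; first by exists \bot%O; exact: pf0.
        move=> V W nV nW; exists (V `|` W)%O; first by move=> /pfU[].
        by move=> y [Uy /not_orP[]].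
      (* If [U] minus [W] were empty, [W] would include [U] and hence belong to [Q]. *)
      move=> W nW; apply: contrapT => no; apply: nW; apply: pf_le QU.
      apply/co_leP => y Uy; apply: contrapT => nWy.
      by apply: no; exists y.
    have [y [Uy cly]] : co_set U `&` cluster F !=set0.
      apply: (co_compact_open U).1.
      by exists \bot%O; [exact: pf0|move=> y []].
    have [V DV Vy] := UD y Uy.
    have [W Wy WV] := compact_open_nbhs (Dopen V DV) Vy.
    have nQW : ~ Q W.
      move=> QW; apply: noD; exists V => //.
      by split; [exact: Dopen|exists W].
    have Wn : nbhs y (co_set W).
      by apply: open_nbhs_nbhs; split=> //; exact: (co_compact_open W).2.
    have FW : F (co_set U `\` co_set W) by exists W.
    have [z [[_ nWz] Wz]] := cly _ _ FW Wn.
    exact: nWz.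
exists x; apply: prime_filter_eq => U.
have oU := (co_compact_open U).2.
(* By sobriety, a compact open set contains [x] exactly when it includes a member of [Q], that is,
   when it is a member of [Q]. *)
have TU : T U <-> open (co_set U) /\ co_set U x by rewrite Tx.
split=> [Ux|QU].
  by have [_ [V QV /co_leP VU]] := TU.2 (conj oU Ux); exact: pf_le QV.
by have [] : open (co_set U) /\ co_set U x by apply/TU; split=> //; exists U.
Qed.

End compact_open_points.

(** * The two functors *)

Section dual_space.
Variable A : s4DeMorganAlgebra.
Implicit Types (a b : A) (P Q : prime_filter A).

Lemma nabla_le a b : (a <= b)%O -> (nabla a <= nabla b)%O.
Proof. by rewrite leEjoin => /eqP <-; rewrite nablaU leUl. Qed.

Lemma dm_neg_swap a b : (dm_neg a <= b)%O -> (dm_neg b <= a)%O.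
Proof. by move=> /dm_neg_anti; rewrite dm_negK. Qed.

Lemma dm_neg1 : dm_neg (\top%O : A) = \bot%O.
Proof. by apply/eqP; rewrite -lex0; apply: dm_neg_swap; exact: lex1. Qed.

Lemma dm_neg0 : dm_neg (\bot%O : A) = \top%O.
Proof. by rewrite -dm_neg1 dm_negK. Qed.

(** An order-inverting involution is an anti-automorphism of the order, so it exchanges meets and
    joins. *)
Lemma dm_negI a b : dm_neg (a `&` b)%O = (dm_neg a `|` dm_neg b)%O.
Proof.
apply/eqP; rewrite eq_le andbC leUx !dm_neg_anti ?leIl ?leIr //=.
by apply: dm_neg_swap; rewrite lexI; apply/andP; split; apply: dm_neg_swap;
  [exact: leUl|exact: leUr].
Qed.

Lemma dm_negU a b : dm_neg (a `|` b)%O = (dm_neg a `&` dm_neg b)%O.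
Proof. by rewrite -[RHS]dm_negK dm_negI !dm_negK. Qed.

Lemma spec_gT P : ~ P (dm_neg \top%O).
Proof. by rewrite dm_neg1; exact: pf0. Qed.

Lemma spec_g0 P : ~ ~ P (dm_neg \bot%O).
Proof. by rewrite dm_neg0; apply; exact: pf1. Qed.

Lemma spec_g_le P a b : (a <= b)%O -> ~ P (dm_neg a) -> ~ P (dm_neg b).
Proof. by move=> /dm_neg_anti ba nPa /(pf_le ba). Qed.

Lemma spec_gI P a b :
  ~ P (dm_neg a) -> ~ P (dm_neg b) -> ~ P (dm_neg (a `&` b)%O).
Proof. by move=> nPa nPb; rewrite dm_negI => /pfU[]. Qed.

Lemma spec_gU P a b :
  ~ P (dm_neg (a `|` b)%O) -> ~ P (dm_neg a) \/ ~ P (dm_neg b).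
Proof. by rewrite dm_negU => nP; apply/not_andP => -[? ?]; apply/nP/pfI. Qed.

(** The complement of a prime filter is a prime ideal, and negation turns it back into a prime
    filter. *)
Definition spec_g P : prime_filter A := @PrimeFilter _ A
  (fun a => ~ P (dm_neg a))
  (@spec_gT P) (@spec_g0 P) (@spec_g_le P) (@spec_gI P) (@spec_gU P).

Definition spec_R P Q : Prop := forall a, P a -> Q (nabla a).

Lemma star_stone a : set_star spec_g (stone a) = stone (dm_neg a).
Proof. by apply/seteqP; split=> P /=; [exact: contrapT|move=> Pa]; apply. Qed.

Lemma nabla_stone a : set_nabla spec_R (stone a) = stone (nabla a).
Proof.
apply/seteqP; split=> Q; first by case=> P Pa; exact.
move=> Qa; have [||P [Pa PQ]] :=
    @prime_filter_theorem _ A [set b | ~ Q (nabla b)] a.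
(* Closure under joins combines additivity of [nabla] with primeness of [Q]. *)
- split=> [|b c bc|b c /=].
  + by rewrite /= nabla0; exact: pf0.
  + by apply: contra_not; apply: pf_le; exact: nabla_le.
  + by rewrite nablaU => nQb nQc /pfU[].
- by apply.
- by exists P => // b /PQ; exact: contrapT.
Qed.

Lemma spec_g_anti P Q :
  specialization P Q -> specialization (spec_g Q) (spec_g P).
Proof.
move=> /specialization_prime_filter PQ; apply/specialization_prime_filter => a.
by apply: contra_not => /PQ.
Qed.

Lemma spec_gK : involutive spec_g.
Proof.
move=> P; apply: prime_filter_eq => a /=.
by rewrite dm_negK; split=> [|Pa]; [exact: contrapT|apply].
Qed.

Lemma spec_R_refl P : spec_R P P.
Proof. by move=> a; apply: pf_le; exact: nabla_ge. Qed.

Lemma spec_R_trans P Q S : spec_R P Q -> spec_R Q S -> spec_R P S.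
Proof. by move=> PQ QS a /PQ/QS; apply: pf_le; exact: nabla_nabla. Qed.

Lemma spec_star (U : set (prime_filter A)) :
  compact_opens (prime_filter A) U ->
  compact_opens (prime_filter A) (set_star spec_g U).
Proof.
move=> /compact_opens_stoneP[a <-].
by rewrite star_stone; exact: compact_opens_stone.
Qed.

Lemma spec_nabla (U : set (prime_filter A)) :
  compact_opens (prime_filter A) U ->
  compact_opens (prime_filter A) (set_nabla spec_R U).
Proof.
move=> /compact_opens_stoneP[a <-].
by rewrite nabla_stone; exact: compact_opens_stone.
Qed.

Lemma spec_sep P Q : ~ spec_R P Q ->
  exists U : set (prime_filter A),
    [/\ compact_opens (prime_filter A) U, U P & ~ set_nabla spec_R U Q].
Proof.
move=> /existsNP[a /not_implyP[Pa nQa]]; exists (stone a); split=> //.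
  exact: compact_opens_stone.
by rewrite nabla_stone.
Qed.

Definition dual_space : s4dmSpectralSpace :=
  @S4DMSpectralSpace (prime_filter A) spec_g spec_R spectral_prime_filter
    spec_g_anti spec_gK spec_R_refl spec_R_trans spec_star spec_nabla spec_sep.

End dual_space.

Section dual_map.
Variables (A B : s4DeMorganAlgebra) (h : A -> B) (hP : s4dm_hom h).

Lemma s4dm_hom_le a b : (a <= b)%O -> (h a <= h b)%O.
Proof. by rewrite !leEmeet -(s4dm_homI hP) => /eqP ->. Qed.

Lemma dual_map1 (P : prime_filter B) : P (h \top%O).
Proof. by rewrite (s4dm_hom1 hP); exact: pf1. Qed.

Lemma dual_map0 (P : prime_filter B) : ~ P (h \bot%O).
Proof. by rewrite (s4dm_hom0 hP); exact: pf0. Qed.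

Lemma dual_map_le (P : prime_filter B) a b : (a <= b)%O -> P (h a) -> P (h b).
Proof. by move=> /s4dm_hom_le; exact: pf_le. Qed.

Lemma dual_mapI (P : prime_filter B) a b :
  P (h a) -> P (h b) -> P (h (a `&` b)%O).
Proof. by rewrite (s4dm_homI hP); exact: pfI. Qed.

Lemma dual_mapU (P : prime_filter B) a b :
  P (h (a `|` b)%O) -> P (h a) \/ P (h b).
Proof. by rewrite (s4dm_homU hP); exact: pfU. Qed.

Definition dual_map (P : dual_space B) : dual_space A := @PrimeFilter _ A
  (fun a => P (h a)) (@dual_map1 P) (@dual_map0 P) (@dual_map_le P)
  (@dual_mapI P) (@dual_mapU P).

Lemma dual_map_stone a : dual_map @^-1` stone a = stone (h a).
Proof. by []. Qed.

(** Every compact open set is some [stone a], with preimage [stone (h a)], so the conditions on sets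
    reduce to identities for [h] at [a]. *)
Lemma dual_map_sfm : spectral_frame_morphism dual_map.
Proof.
split=> [U /compact_opens_stoneP[a <-]|P|U /compact_opens_stoneP[a <-]].
- exact: compact_opens_stone.
- by apply: prime_filter_eq => a /=; rewrite (s4dm_homN hP).
- by rewrite nabla_stone !dual_map_stone nabla_stone (s4dm_hom_nabla hP).
Qed.

End dual_map.

(** * The algebra of a spectral space *)

Section dual_algebra.
Variable X : s4dmSpectralSpace.
Local Notation co := (compact_open (sp_spectral X)).
Implicit Types U V : co.

Definition co_star U : co :=
  CompactOpen (sp_spectral X) (sp_star (co_compact_open U)).

Definition co_nabla U : co :=
  CompactOpen (sp_spectral X) (sp_nabla (co_compact_open U)).

Lemma co_star_anti U V : (U <= V)%O -> (co_star V <= co_star U)%O.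
Proof.
by move=> /co_leP UV; apply/co_leP => x; apply: contra_not; exact: UV.
Qed.

Lemma co_starK : involutive co_star.
Proof.
move=> U; apply: compact_open_eq; apply/seteqP; split=> x /=;
  rewrite /set_star /= sp_gK; [exact: contrapT|by move=> Ux; apply].
Qed.

Lemma co_nablaU U V : co_nabla (U `|` V)%O = (co_nabla U `|` co_nabla V)%O.
Proof.
apply: compact_open_eq; apply/seteqP; split=> y.
  by move=> [x [Ux|Vx] xy]; [left|right]; exists x.
by move=> [] [x Ux xy]; exists x => //; [left|right].
Qed.

Lemma co_nabla0 : co_nabla \bot%O = \bot%O.
Proof. by apply: compact_open_eq; rewrite -subset0 => y []. Qed.

Lemma co_nabla_ge U : (U <= co_nabla U)%O.
Proof. by apply/co_leP => x Ux; exists x => //; exact: sp_R_refl. Qed.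

Lemma co_nabla_nabla U : (co_nabla (co_nabla U) <= co_nabla U)%O.
Proof.
by apply/co_leP => z [y [x Ux xy] yz]; exists x => //; exact: sp_R_trans yz.
Qed.

Definition dual_algebra : s4DeMorganAlgebra :=
  @S4DeMorganAlgebra (@DeMorganAlgebra _ co co_star co_star_anti co_starK)
    co_nabla co_nablaU co_nabla0 co_nabla_ge co_nabla_nabla.

End dual_algebra.

Section dual_hom.
Variables (X Y : s4dmSpectralSpace) (f : X -> Y).
Hypothesis fP : spectral_frame_morphism f.

Definition dual_hom (U : dual_algebra Y) : dual_algebra X :=
  CompactOpen (sp_spectral X) (sfm_spectral fP (co_compact_open U)).

Lemma dual_hom_s4dm : s4dm_hom dual_hom.
Proof.
(* Preimages commute with the lattice operations by conversion; only negation and [nabla] remain. *)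
split=> [U V|U V|U|||U]; apply: compact_open_eq => //=.
- by apply/seteqP; split=> x /=; rewrite /set_star /= (sfm_g fP).
- exact: (sfm_nabla fP (co_compact_open U)).
Qed.

End dual_hom.

(** The functors are left transparent, because the types of the units and their naturality rely on
    the object and morphism parts computing. *)
Definition spectrum : functor (op_category S4DM) S4DMSpec.
Proof.
apply: (@Functor (op_category S4DM) S4DMSpec dual_space (fun A B h =>
  exist _ (dual_map (proj2_sig h)) (dual_map_sfm (proj2_sig h)))).
- by move=> A; apply: mor_eq; apply/funext => P; exact: prime_filter_eq.
- by move=> A B C g f; apply: mor_eq; apply/funext => P; exact: prime_filter_eq.
Defined.

Definition compact_opens_algebra : functor S4DMSpec (op_category S4DM).
Proof.
apply: (@Functor S4DMSpec (op_category S4DM) dual_algebra (fun X Y f =>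
  exist _ (dual_hom (proj2_sig f)) (dual_hom_s4dm (proj2_sig f)))).
- by move=> X; apply: mor_eq; apply/funext => U; exact: compact_open_eq.
- by move=> X Y Z g f; apply: mor_eq; apply/funext => U; exact: compact_open_eq.
Defined.

(** * The units *)

Section unit_algebra.
Variable A : s4DeMorganAlgebra.

Definition unit_algebra (a : A) : dual_algebra (dual_space A) :=
  CompactOpen (sp_spectral (dual_space A)) (compact_opens_stone a).

Lemma unit_algebra_s4dm : s4dm_hom unit_algebra.
Proof.
split=> [a b|a b|a|||a]; apply: compact_open_eq.
- exact: stoneI.
- exact: stoneU.
- by rewrite /= star_stone.
- exact: stone0.
- exact: stone1.
- by rewrite /= nabla_stone.
Qed.

Lemma unit_algebra_inj : injective unit_algebra.
Proof. by move=> a b /(congr1 (@co_set _ _))/stone_inj. Qed.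

Lemma unit_algebra_surj U : exists a, unit_algebra a = U.
Proof.
have [a aU] := compact_opens_stoneP (co_compact_open U).
by exists a; exact: compact_open_eq.
Qed.

End unit_algebra.

Section unit_space.
Variable X : s4dmSpectralSpace.

Definition unit_space (x : X) : dual_space (dual_algebra X) :=
  @point_filter X (sp_spectral X) x.

(** Compact opens of the double dual are the sets [stone V], and the preimage of [stone V] under the
    unit is [V] itself. *)
Lemma unit_space_sfm : spectral_frame_morphism unit_space.
Proof.
split=> [U /compact_opens_stoneP[V <-]|x|U /compact_opens_stoneP[V <-]].
- exact: (co_compact_open V).
- apply: prime_filter_eq => U /=; rewrite /set_star /=.
  by split=> [Ux|]; [apply|exact: contrapT].
- by rewrite nabla_stone.
Qed.

(** As [P] is the point filter of [k P], the point [k P] lies in [U] exactly when [U] is a member of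
    [P]. *)
Lemma unit_space_image (U : dual_algebra X) k :
  cancel k unit_space -> k @^-1` co_set U = stone U.
Proof. by move=> kK; apply/funext => P; rewrite -[in RHS](kK P). Qed.

End unit_space.

(** * Inverses of the units and the duality *)

Lemma s4dm_hom_inverse (A B : s4DeMorganAlgebra) (h : A -> B) k :
  cancel h k -> cancel k h -> s4dm_hom h -> s4dm_hom k.
Proof.
move=> hK kK hP; split=> [a b|a b|a|||a]; apply: (can_inj hK).
- by rewrite (s4dm_homI hP) !kK.
- by rewrite (s4dm_homU hP) !kK.
- by rewrite (s4dm_homN hP) !kK.
- by rewrite (s4dm_hom0 hP) kK.
- by rewrite (s4dm_hom1 hP) kK.
- by rewrite (s4dm_hom_nabla hP) !kK.
Qed.

(** Unlike for algebras, the inverse of a bijective morphism of spaces need not be a morphism. Here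
    it is one because its preimages of compact open sets are again sets [stone U]. *)
Lemma unit_space_inverse (X : s4dmSpectralSpace) k :
  cancel (@unit_space X) k -> cancel k (@unit_space X) ->
  spectral_frame_morphism k.
Proof.
move=> uK kK; split=> [U cU|P|U cU].
- rewrite (unit_space_image (CompactOpen (sp_spectral X) cU) kK).
  exact: compact_opens_stone.
- by apply: (can_inj uK); rewrite (sfm_g (unit_space_sfm X)) !kK.
- pose V : dual_algebra X := CompactOpen (sp_spectral X) cU.
  rewrite (unit_space_image V kK) nabla_stone.
  exact: (unit_space_image (nabla V) kK).
Qed.

Theorem theorem3p26 : dually_equivalent S4DM S4DMSpec.
Proof.
(* Both units run against the required direction: in the opposite category the unit of an algebra is
   an arrow from its double dual to the algebra, while the unit of a space goes from the space to
   its double dual. *)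
exists spectrum, compact_opens_algebra; split; apply: naturally_isomorphic_sym.
- apply: (@natural_isomorphism _ _ (comp_functor compact_opens_algebra spectrum)
    (id_functor _) (fun A => exist _ _ (unit_algebra_s4dm A))).
    by move=> A B f; apply: mor_eq; apply/funext => a; exact: compact_open_eq.
  move=> A; have [k [uK kK]] :=
    bijection_inverse (@unit_algebra_inj A) (@unit_algebra_surj A).
  exists (exist _ k (s4dm_hom_inverse uK kK (unit_algebra_s4dm A))).
  by split; apply: mor_eq; apply/funext.
- apply: (@natural_isomorphism _ _ (id_functor _)
    (comp_functor spectrum compact_opens_algebra)
    (fun X => exist _ _ (unit_space_sfm X))).
    by move=> X Y f; apply: mor_eq; apply/funext => x; exact: prime_filter_eq.
  move=> X; have [k [uK kK]] :=
    bijection_inverse (@point_filter_inj X (sp_spectral X)) point_filter_surj.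
  exists (exist _ k (unit_space_inverse uK kK)).
  by split; apply: mor_eq; apply/funext.
Qed.
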